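(* Suppose that for every $\rho\in(0,1)$ the function $G(\cdot\,;\rho)$ is convex. Let $(\alpha_0,\beta_0,\gamma_0,v_0)$ be smooth functions on $(0,1)$ with $\alpha_0\ge0$, $\alpha_0'>0$, and let $(\alpha,\beta,\gamma,v)$ be smooth functions on $(0,1)$. Let $\Xi^0=(\xi^0_i)_{i=1}^7$ and $\Xi=(\xi_i)_{i=1}^7$ be defined by $$\Xi^0=\Big(\beta_0\rho^{2/3},\tfrac{\alpha_0}{\rho},\tfrac{\alpha_0}{\rho},\tfrac{\gamma_0}{\rho^{1/3}},\tfrac{3\gamma_0'}{2}\rho^{2/3},\tfrac{3\gamma_0'}{2}\rho^{2/3},\alpha_0'\rho^{2/3}\Big),\quad \Xi=\Big(\beta\rho^{2/3},\tfrac{\alpha}{\rho},\tfrac{\alpha}{\rho},\tfrac{\gamma}{\rho^{1/3}},\tfrac{3\gamma'}{2}\rho^{2/3},\tfrac{3\gamma'}{2}\rho^{2/3},\alpha'\rho^{2/3}\Big),$$ and let $\Gamma^0=\big(\alpha_0'(\rho/\alpha_0)^{2/3},(\alpha_0/\rho)^{1/3},(\alpha_0/\rho)^{1/3}\big)$. Suppose that for $\tau>0$ and $\lambda>0$ the following discrete system holds on $(0,1)$ (sum over repeated $i=1,\dots,7$ in the first equation): $$\frac{v-v_0}{\tau}=\frac{d}{d\rho}\Big(3\rho^{2/3}G_{,i}(\Xi)\Omega^i_{,1}(\Gamma^0)\Big)-\rho^{-1/3}G_{,i}(\Xi)\big(\Omega^i_{,2}(\Gamma^0)+\Omega^i_{,3}(\Gamma^0)\big),$$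 $$\frac{\xi_i-\xi_i^0}{\tau}=3\rho^{2/3}\frac{d}{d\rho}\big(\Omega^i_{,1}(\Gamma^0)v\big),\quad i=1,5,6,7,$$ $$\frac{\xi_i-\xi_i^0}{\tau}=\rho^{-1/3}\big(\Omega^i_{,2}(\Gamma^0)+\Omega^i_{,3}(\Gamma^0)\big)v,\quad i=2,3,4,$$ $$\xi_2(1)=\xi_3(1)=\lambda,\qquad \xi_2,\xi_3\ge0,\qquad \xi_7>0.$$ Then $\eta(v,\Xi)=\frac12v^2+G(\Xi)$ satisfies the discrete entropy inequality $$\frac{\eta(v,\Xi)-\eta(v_0,\Xi^0)}{\tau}-\frac{d}{d\rho}\Big(3\rho^{2/3}G_{,i}(\Xi)\Omega^i_{,1}(\Gamma^0)v\Big)\le0\qquad\text{on }(0,1).$$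
   Context: Here $G(\Xi;\rho)$ is a real-valued function, smooth in $(\Xi,\rho)$, defined for $\rho\in(0,1)$ and $\Xi=(\xi_1,\dots,\xi_7)\in\mathbb{R}\times(0,\infty)^2\times\mathbb{R}^3\times(0,\infty)$. It arises from a stored energy $\Phi(v_1,v_2,v_3)=\bar G(v_1,v_2,v_3,v_2v_3,v_1v_3,v_1v_2,v_1v_2v_3)$ via $$G(\Xi;\rho)=\bar G\big(\xi_1,\xi_2^{1/3},\xi_3^{1/3},\xi_4/\rho^{1/3},\xi_5/\rho^{1/3},\xi_6/\rho^{1/3},\xi_7/\rho^{2/3}\big).$$ For $V=(v_1,v_2,v_3)$, $$\Omega(V;\rho)=\big(v_1,\ v_2^3,\ v_3^3,\ v_2v_3\rho^{1/3},\ v_1v_3\rho^{1/3},\ v_1v_2\rho^{1/3},\ v_1v_2v_3\rho^{2/3}\big).$$ The explicit dependence on $\rho$ is suppressed in the notation; $G_{,i}=\partial G/\partial\xi_i$ and $\Omega^i_{,j}=\partial\Omega^i/\partial v_j$ are partial derivatives at fixed $\rho$, whereas $d/d\rho$ is the total derivative of the composed function of $\rho$. A prime denotes $d/d\rho$. Values at $\rho=1$ are understood as limits. *)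

(* Defs.v *)
From HB Require Import structures.
From mathcomp Require Import all_boot all_order all_algebra.
From mathcomp Require Import all_classical all_reals all_analysis.
Set Implicit Arguments.
Unset Strict Implicit.
Unset Printing Implicit Defensive.
Import Order.TTheory GRing.Theory Num.Theory.
Import numFieldNormedType.Exports.
Local Open Scope classical_set_scope.
Local Open Scope ring_scope.

(* One-based index: the k-th coordinate of X is [X 0 (idx k)], 1 <= k. *)
Definition idx {n : nat} (k : nat) : 'I_n.+1 := inord k.-1.

(* [Ck n U f] means that f is n times continuously differentiable on U.  It is
   meant for open U: derivatives are two-sided and only depend on f near the
   points of U, so the values of f away from U are irrelevant. *)
Fixpoint Ck {R : realType} {V : normedModType R} (n : nat) (U : set V)
    (f : V -> R) : Prop :=
  match n with
  | 0%N => forall x, U x -> {for x, continuous f}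
  | m.+1 => (forall x, U x -> differentiable f x) /\
            (forall w : V, Ck m U (fun x => 'D_w f x))
  end.

Definition smooth_on {R : realType} {V : normedModType R} (U : set V)
    (f : V -> R) : Prop := forall n, Ck n U f.

Definition smooth01 {R : realType} (f : R -> R) : Prop :=
  smooth_on (`]0, 1[%classic : set R^o) f.

Section Setting.
Context {R : realType}.

(* R x (0,oo)^2 x R^3 x (0,oo), the domain of G( . ; rho). *)
Definition domG : set 'rV[R]_7 :=
  [set X | [/\ 0 < X 0 (idx 2), 0 < X 0 (idx 3) & 0 < X 0 (idx 7)]].

(* G(Xi; rho) in terms of Gbar; it is only meaningful for Xi in domG and
   0 < rho < 1. *)
Definition G_of (Gbar : 'rV[R]_7 -> R) (X : 'rV[R]_7) (rho : R) : R :=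
  Gbar (\row_(i < 7) [:: X 0 (idx 1);
                         X 0 (idx 2) `^ (1 / 3);
                         X 0 (idx 3) `^ (1 / 3);
                         X 0 (idx 4) / rho `^ (1 / 3);
                         X 0 (idx 5) / rho `^ (1 / 3);
                         X 0 (idx 6) / rho `^ (1 / 3);
                         X 0 (idx 7) / rho `^ (2 / 3)]`_i).

Definition Omega (V : 'rV[R]_3) (rho : R) : 'rV[R]_7 :=
  let v1 := V 0 (idx 1) in let v2 := V 0 (idx 2) in let v3 := V 0 (idx 3) in
  \row_(i < 7) [:: v1; v2 ^+ 3; v3 ^+ 3;
                   v2 * v3 * rho `^ (1 / 3);
                   v1 * v3 * rho `^ (1 / 3);
                   v1 * v2 * rho `^ (1 / 3);
                   v1 * v2 * v3 * rho `^ (2 / 3)]`_i.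

(* G_{,i} and Omega^i_{,j}: partial derivatives at fixed rho. *)
Definition dG (G : 'rV[R]_7 -> R -> R) (i : 'I_7) (X : 'rV[R]_7) (rho : R) : R :=
  'D_(delta_mx 0 i) (fun Y => G Y rho) X.

Definition dOmega (i : 'I_7) (j : 'I_3) (V : 'rV[R]_3) (rho : R) : R :=
  'D_(delta_mx 0 j) (fun W => Omega W rho 0 i) V.

Definition Xi_of (alpha beta gamma : R -> R) (rho : R) : 'rV[R]_7 :=
  \row_(i < 7) [:: beta rho * rho `^ (2 / 3);
                   alpha rho / rho;
                   alpha rho / rho;
                   gamma rho / rho `^ (1 / 3);
                   3 * derive1 gamma rho / 2 * rho `^ (2 / 3);
                   3 * derive1 gamma rho / 2 * rho `^ (2 / 3);
                   derive1 alpha rho * rho `^ (2 / 3)]`_i.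

Definition Gamma_of (alpha : R -> R) (rho : R) : 'rV[R]_3 :=
  \row_(i < 3) [:: derive1 alpha rho * (rho / alpha rho) `^ (2 / 3);
                   (alpha rho / rho) `^ (1 / 3);
                   (alpha rho / rho) `^ (1 / 3)]`_i.

Definition entropy (G : 'rV[R]_7 -> R -> R) (v : R) (X : 'rV[R]_7) (rho : R) : R :=
  v ^+ 2 / 2 + G X rho.

End Setting.

(* Main.v *)
Require Import Defs.
From HB Require Import structures.
From mathcomp Require Import all_boot all_order all_algebra.
From mathcomp Require Import all_classical all_reals all_analysis.
From mathcomp Require Import ring lra.
Set Implicit Arguments.
Unset Strict Implicit.
Unset Printing Implicit Defensive.
Import Order.TTheory GRing.Theory Num.Theory.
Import numFieldNormedType.Exports.
Local Open Scope classical_set_scope.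
Local Open Scope ring_scope.

(* Convexity bounds [G(Xi) - G(Xi0)] by [G_{,i}(Xi) (xi_i - xi0_i)], and
   [v^2/2 - v0^2/2 <= v (v - v0)], so the entropy increment is controlled by
   testing the system with [v] and [G_{,i}(Xi)]. In the result everything cancels
   against the flux derivative except the terms
     [G_{,i} v (3 rho^(2/3) (Omega^i_{,1})' - rho^(-1/3) (Omega^i_{,2} + Omega^i_{,3}))]
   for [i = 1, 5, 6, 7], which vanish identically along [Gamma0], while
   [Omega^i_{,1} = 0] for [i = 2, 3, 4]. Strict positivity of [alpha] and [alpha0],
   needed for [Xi] and [Xi0] to lie in the domain of [G], follows from
   nonnegativity and monotonicity. *)

(** * Tangent inequality, positivity and elementary differentiability *)

(** For [0 < h <= 1], convexity at [h *: y + (1 - h) *: x = h *: (y - x) + x] bounds the difference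
    quotient by [f y - f x]; the bound survives the limit from the right, which equals the
    directional derivative. *)
Lemma convex_tangent (R : realType) (V : normedModType R) (D : set V)
    (f : V -> R) (x y : V) :
  convex_function D f -> D x -> D y -> derivable f x (y - x) ->
  f x + 'D_(y - x) f x <= f y.
Proof.
move=> fconvex Dx Dy dfx; rewrite -lerBrDl.
apply: (cvgr_to_le (cvg_dnbhs_at_right dfx)).
near=> h.
have h0 : 0 < h by near: h; exact: nbhs_right_gt.
have h1 : h <= 1 by near: h; exact: nbhs_right_le.
have : f (h *: y + (1 - h) *: x) <= h * f y + (1 - h) * f x :=
  fconvex (Itv01 (ltW h0) h1) y x (mem_set Dy) (mem_set Dx).
have -> : h *: y + (1 - h) *: x = h *: (y - x) + x.
  by rewrite scalerBr scalerBl scale1r -addrA [- _ + x]addrC.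
rewrite /= [_ *: (_ - f x)]/(_ * _) ler_pdivrMl//; lra.
Unshelve. all: by end_near. Qed.

(** A coordinate is linear, so its difference quotients are constant in the step. *)
Lemma is_derive_coord (R : realType) (m n : nat) (M N : 'M[R]_(m, n)) i j :
  is_derive M N (fun A : 'M[R]_(m, n) => A i j : R) (N i j).
Proof.
apply: DeriveDef; first exact/diff_derivable/differentiable_coord.
apply/cvg_lim => //; apply: cvg_near_cst; near=> h.
have h0 : h != 0 by near: h; exact: nbhs_dnbhs_neq.
by rewrite /= !mxE addrK scalerA mulVf// scale1r.
Unshelve. all: by end_near. Qed.

Lemma derive_row_sum (R : realType) (n : nat) (f : 'rV[R]_n -> R)
    (X w : 'rV[R]_n) : differentiable f X ->
  'D_w f X = \sum_(i < n) w 0 i * 'D_(delta_mx 0 i) f X.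
Proof.
move=> df; rewrite deriveE// {1}[w]row_sum_delta linear_sum.
by apply: eq_bigr => i _; rewrite linearZ deriveE.
Qed.

(** Since [f] is strictly increasing, [f x] exceeds [f (x / 2)], which is already nonnegative. *)
Lemma gt0_of_derive1_gt0 (R : realType) (f : R -> R) :
  (forall x : R, 0 < x < 1 -> derivable f x 1) ->
  (forall x : R, 0 < x < 1 -> 0 <= f x) ->
  (forall x : R, 0 < x < 1 -> 0 < derive1 f x) ->
  forall x : R, 0 < x < 1 -> 0 < f x.
Proof.
move=> df f0 f'0 x /andP[x0 x1].
have h01 : 0 < x / 2 < 1 by apply/andP; split; lra.
apply: (le_lt_trans (f0 _ h01)).
apply: (@gtr0_derive1_lt_oo _ f 0 1).
- by move=> y /[!in_itv]/=; exact: df.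
- by move=> y /[!in_itv]/=; exact: f'0.
- move=> y /[!inE]/= /[!in_itv]/= y01.
  exact/differentiable_continuous/derivable1_diffP/df.
- by rewrite in_itv.
- by rewrite in_itv/= x0.
- lra.
Qed.

Lemma smooth_on_differentiable (R : realType) (V : normedModType R)
    (U : set V) (f : V -> R) x : smooth_on U f -> U x -> differentiable f x.
Proof. by move=> /(_ 1%N)[+ _]; exact. Qed.

Lemma smooth_on_derive (R : realType) (V : normedModType R)
    (U : set V) (f : V -> R) w : smooth_on U f -> smooth_on U ('D_w f).
Proof. by move=> fs n; have [_] := fs n.+1; exact. Qed.

Lemma smooth01_derivable (R : realType) (f : R -> R) (x : R) :
  smooth01 f -> 0 < x < 1 -> derivable f x 1.
Proof.
move=> fs x01; apply/derivable1_diffP.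
by apply: (smooth_on_differentiable fs); rewrite /= in_itv.
Qed.

Lemma smooth01_derive1 (R : realType) (f : R -> R) :
  smooth01 f -> smooth01 (derive1 f).
Proof.
move=> fs; have -> : derive1 f = 'D_1 f by apply/funext => x; exact: derive1E.
exact: smooth_on_derive.
Qed.


(** * Partial derivatives of [Omega] *)

Lemma idxE (n k : nat) : (k.-1 < n.+1)%N -> @idx n k = k.-1 :> nat.
Proof. exact: inordK. Qed.

(** The direction [W] is kept general so that one computation with the product rule yields all three
    partial derivatives. *)
Lemma is_derive_Omega (R : realType) (V W : 'rV[R]_3) (rho : R) (i : 'I_7) :
  let v1 := V 0 (idx 1) in let v2 := V 0 (idx 2) in let v3 := V 0 (idx 3) in
  let w1 := W 0 (idx 1) in let w2 := W 0 (idx 2) in let w3 := W 0 (idx 3) in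
  is_derive V W (fun U => Omega U rho 0 i)
   [:: w1; 3 * v2 ^+ 2 * w2; 3 * v3 ^+ 2 * w3;
       (w2 * v3 + v2 * w3) * rho `^ (1 / 3);
       (w1 * v3 + v1 * w3) * rho `^ (1 / 3);
       (w1 * v2 + v1 * w2) * rho `^ (1 / 3);
       (w1 * v2 * v3 + v1 * w2 * v3 + v1 * v2 * w3) * rho `^ (2 / 3)]`_i.
Proof.
move=> v1 v2 v3 w1 w2 w3.
pose c k (A : 'rV[R]_3) : R := A 0 (idx k).
have d k : is_derive V W (c k) (W 0 (idx k)) := is_derive_coord V W 0 (idx k).
have E (g : 'rV[R]_3 -> R) (a b : R) : (forall U, Omega U rho 0 i = g U) ->
  is_derive V W g a -> a = b -> is_derive V W (fun U => Omega U rho 0 i) b.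
  by move=> /funext -> ? <-.
case: i E => [[|[|[|[|[|[|[|m]]]]]]] mlt] E //.
- by apply: (E (c 1%N) _ _ _ (d 1%N)) => // U; rewrite !mxE.
- apply: (E (c 2%N ^+ 3) _ _ _ (is_deriveX 3 (d 2%N))) => [U|].
    by rewrite !mxE.
  by rewrite /= /GRing.scale /= /c -/v2 -/w2; ring.
- apply: (E (c 3%N ^+ 3) _ _ _ (is_deriveX 3 (d 3%N))) => [U|].
    by rewrite !mxE.
  by rewrite /= /GRing.scale /= /c -/v3 -/w3; ring.
- apply: (E (rho `^ (1 / 3) \*: (c 2%N * c 3%N)) _ _ _
    (is_deriveZ _ (is_deriveM (d 2%N) (d 3%N)))) => [U|].
    by rewrite !mxE /= mulrC.
  by rewrite /= /GRing.scale /= /c -/v2 -/w2 -/v3 -/w3; ring.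
- apply: (E (rho `^ (1 / 3) \*: (c 1%N * c 3%N)) _ _ _
    (is_deriveZ _ (is_deriveM (d 1%N) (d 3%N)))) => [U|].
    by rewrite !mxE /= mulrC.
  by rewrite /= /GRing.scale /= /c -/v1 -/w1 -/v3 -/w3; ring.
- apply: (E (rho `^ (1 / 3) \*: (c 1%N * c 2%N)) _ _ _
    (is_deriveZ _ (is_deriveM (d 1%N) (d 2%N)))) => [U|].
    by rewrite !mxE /= mulrC.
  by rewrite /= /GRing.scale /= /c -/v2 -/w2 -/v1 -/w1; ring.
- apply: (E (rho `^ (2 / 3) \*: (c 1%N * c 2%N * c 3%N)) _ _ _
    (is_deriveZ _ (is_deriveM (is_deriveM (d 1%N) (d 2%N)) (d 3%N)))) => [U|].
    by rewrite !mxE /= mulrC.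
  rewrite /= -[(c 1%N * c 2%N) V]/(v1 * v2) /GRing.scale /= /c.
  by rewrite -/v1 -/w1 -/v2 -/w2 -/v3 -/w3; ring.
Qed.

Lemma dOmegaE (R : realType) (V : 'rV[R]_3) (rho : R) (i : 'I_7) :
  let v1 := V 0 (idx 1) in let v2 := V 0 (idx 2) in let v3 := V 0 (idx 3) in
  let a := rho `^ (1 / 3) in let b := rho `^ (2 / 3) in
  [/\ dOmega i (idx 1) V rho =
        [:: 1; 0; 0; 0; v3 * a; v2 * a; v2 * v3 * b]`_i,
      dOmega i (idx 2) V rho =
        [:: 0; 3 * v2 ^+ 2; 0; v3 * a; 0; v1 * a; v1 * v3 * b]`_i &
      dOmega i (idx 3) V rho =
        [:: 0; 0; 3 * v3 ^+ 2; v2 * a; v1 * a; 0; v1 * v2 * b]`_i].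
Proof.
move=> v1 v2 v3 a b.
have dE j := @derive_val _ _ _ _ _ _ _ (is_derive_Omega V (delta_mx 0 j) rho i).
(* Positivity of [j] and [k] matters: the shift [k.-1] identifies [idx 0] with [idx 1]. *)
have deltaE j k : (0 < k <= 3)%N -> (0 < j <= 3)%N ->
    (delta_mx 0 (idx j) : 'rV[R]_3) 0 (idx k) = (k == j)%:R.
  case: k => // k; case: j => // j hk hj.
  by rewrite mxE -[idx k.+1 == _](inj_eq val_inj) /= !idxE.
split; rewrite /dOmega dE !deltaE//=;
  case: i {dE} => [[|[|[|[|[|[|[|m]]]]]]] ?] //=; rewrite -/v1 -/v2 -/v3 -/a -/b; ring.
Qed.

(** * Derivatives of the energy at fixed [rho] and along curves *)

(** Freezing [rho] amounts to a direction with zero last component. In this form [dG] is a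
    derivative of the jointly smooth energy and inherits its smoothness in both variables. *)
Lemma dG_pair (R : realType) (G : 'rV[R]_7 -> R -> R) i X rho :
  dG G i X rho =
  'D_((delta_mx 0 i, 0) : 'rV[R]_7 * R) (fun p => G p.1 p.2) (X, rho).
Proof.
rewrite /dG /derive; congr (lim (_ @ 0^')); apply/funext => h /=.
by rewrite scaler0 add0r.
Qed.

Section SmoothEnergy.
Context (R : realType) (G : 'rV[R]_7 -> R -> R) (U : set ('rV[R]_7 * R)).
Hypothesis G_smooth : smooth_on U (fun p => G p.1 p.2).

Lemma smooth_section_differentiable X rho :
  U (X, rho) -> differentiable (fun Y => G Y rho) X.
Proof.
move=> UX; pose Gp (p : 'rV[R]_7 * R) := G p.1 p.2.
rewrite (_ : (fun Y => _) = Gp \o (fun Y => (Y, rho)))//.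
apply: differentiable_comp; last exact: smooth_on_differentiable G_smooth _.
exact: differentiable_pair.
Qed.

(** Chain rule along [r |-> (X r, r)], which carries both the dependence through [X] and the
    explicit one on [r]. *)
Lemma derivable_dG_curve i (X : R -> 'rV[R]_7) (rho : R) :
  U (X rho, rho) -> derivable X rho 1 ->
  derivable (fun r => dG G i (X r) r) rho 1.
Proof.
move=> UX dX; pose w : 'rV[R]_7 * R := (delta_mx 0 i, 0).
rewrite (_ : (fun r => _) = ('D_w (fun p : 'rV[R]_7 * R => G p.1 p.2))
  \o (fun r : R => (X r, r))); last first.
  by apply/funext => r; rewrite dG_pair.
apply/derivable1_diffP; apply: differentiable_comp.
  by apply: differentiable_pair => //; exact/derivable1_diffP.
exact: (smooth_on_differentiable (smooth_on_derive _ G_smooth)).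
Qed.

End SmoothEnergy.

(** The tangent at [X] is taken in the direction [X0 - X], which puts the gradient at the new state
    [X], as in the implicit scheme; the sign is then reversed. *)
Lemma domG_convex_tangent (R : realType) (f : 'rV[R]_7 -> R) X X0 :
  convex_function (@domG R) f -> domG X -> domG X0 -> differentiable f X ->
  f X - f X0 <= \sum_(i < 7) 'D_(delta_mx 0 i) f X * (X 0 i - X0 0 i).
Proof.
move=> fconvex DX DX0 df.
have := convex_tangent fconvex DX DX0 (@diff_derivable _ _ _ _ _ (X0 - X) df).
rewrite derive_row_sum// => tangent.
rewrite (eq_bigr (fun i => - ((X0 - X) 0 i * 'D_(delta_mx 0 i) f X))).
  by rewrite sumrN; lra.
by move=> i _; rewrite !mxE; ring.
Qed.

(** * Cube roots and the null Lagrangian identity along [Gamma_of] *)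

(** Every power is reduced to the cube root so that later identities are rational and [field]
    decides them. The exponents [1 / 3 - 1] and [2 / 3 - 1] come from differentiating the powers of
    [alpha]. *)
Lemma powR_thirds (R : realType) (x : R) : 0 < x ->
  [/\ x `^ (2 / 3) = (x `^ (1 / 3)) ^+ 2, x `^ (- (1 / 3)) = (x `^ (1 / 3))^-1,
      x `^ (1 / 3 - 1) = ((x `^ (1 / 3)) ^+ 2)^-1 &
      x `^ (2 / 3 - 1) = (x `^ (1 / 3))^-1].
Proof.
move=> x0; have sq : x `^ (2 / 3) = (x `^ (1 / 3)) ^+ 2.
  by rewrite -powR_mulrn ?powR_ge0// -powRrM; congr (_ `^ _); field.
rewrite -sq -!powRN; split=> //; by congr (_ `^ _); field.
Qed.

Lemma Gamma_ofE (R : realType) (alpha : R -> R) (r : R) :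
  0 < r -> 0 < alpha r ->
  let a := alpha r `^ (1 / 3) in let s := r `^ (1 / 3) in
  [/\ Gamma_of alpha r 0 (idx 1) = derive1 alpha r * (s / a) ^+ 2,
      Gamma_of alpha r 0 (idx 2) = a / s & Gamma_of alpha r 0 (idx 3) = a / s].
Proof.
move=> r0 a0 a s; have ia0 : 0 < (alpha r)^-1 by rewrite invr_gt0.
have ir0 : 0 < r^-1 by rewrite invr_gt0.
have third_inv (x : R) : 0 < x -> x^-1 `^ (1 / 3) = (x `^ (1 / 3))^-1.
  move=> x0; rewrite -powR_inv1 ?ltW// -powRrM mulN1r.
  by case: (powR_thirds x0).
rewrite /Gamma_of !mxE !idxE//=.
have [-> _ _ _] := powR_thirds (mulr_gt0 r0 ia0).
by rewrite !powRM ?ltW// !third_inv.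
Qed.

(* The radial form of the Piola identity for the minors entering [Omega]. *)
Lemma Omega_null_lagrangian (R : realType) (alpha : R -> R) (i : 'I_7) (rho : R) :
  (forall r : R, 0 < r < 1 -> derivable alpha r 1) ->
  (forall r : R, 0 < r < 1 -> 0 < alpha r) ->
  i \in [:: idx 1; idx 5; idx 6; idx 7] -> 0 < rho < 1 ->
  is_derive rho (1 : R)
    (fun r => dOmega i (idx 1) (Gamma_of alpha r) r)
    (rho `^ (- (1 / 3)) * (dOmega i (idx 2) (Gamma_of alpha rho) rho
       + dOmega i (idx 3) (Gamma_of alpha rho) rho) / (3 * rho `^ (2 / 3))).
Proof.
move=> dalpha alpha0 iI rho01.
have [rho0 rho1] := andP rho01.
have arho0 := alpha0 _ rho01.
(* Along [Gamma_of alpha] the second and third entries are [(alpha / r)^(1/3)], so the factors of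
   [r] in [Omega] cancel and only powers of [alpha] remain. *)
have A (r : R) : 0 < r < 1 -> dOmega i (idx 1) (Gamma_of alpha r) r =
    [:: 1; 0; 0; 0; alpha r `^ (1 / 3); alpha r `^ (1 / 3);
        alpha r `^ (2 / 3)]`_i.
  move=> r01; have /andP[r0 _] := r01; have ar0 := alpha0 _ r01.
  have [-> _ _] := dOmegaE (Gamma_of alpha r) r i.
  have [_ -> ->] := Gamma_ofE r0 ar0.
  have [-> _ _ _] := powR_thirds r0; have [-> _ _ _] := powR_thirds ar0.
  have s0 : r `^ (1 / 3) != 0 by rewrite gt_eqF ?powR_gt0.
  by case: i {iI} => [[|[|[|[|[|[|[|m]]]]]]] ?] //=; field.
have dpow p : is_derive rho (1 : R) (fun r => alpha r `^ p)
    (p * alpha rho `^ (p - 1) * derive1 alpha rho).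
  apply: (@is_derive1_comp _ (fun x => x `^ p) alpha).
  exact: is_derive1_powR.
  by rewrite derive1E; exact/derivableP/dalpha.
(* The closed form is valid only on [(0, 1)], so it replaces the original function just near
   [rho]. *)
apply: (@near_eq_is_derive _ _ _ (fun r => [:: 1; 0; 0; 0; alpha r `^ (1 / 3);
    alpha r `^ (1 / 3); alpha r `^ (2 / 3)]`_i)).
  near=> r; rewrite [RHS]A//; apply/andP; split; near: r.
    exact: lt_nbhsr.
  exact: lt_nbhsl.
have [_ -> ->] := dOmegaE (Gamma_of alpha rho) rho i.
have [-> -> ->] := Gamma_ofE rho0 arho0.
have [-> -> _ _] := powR_thirds rho0.
have [_ _ e1 e2] := powR_thirds arho0.
have s0 : rho `^ (1 / 3) != 0 by rewrite gt_eqF ?powR_gt0.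
have a0 : alpha rho `^ (1 / 3) != 0 by rewrite gt_eqF ?powR_gt0.
move: iI; rewrite !inE -!(inj_eq val_inj) /= !idxE// => /or4P[] /eqP -> /=.
- rewrite addr0 mulr0 mul0r; exact: is_derive_cst.
- by apply: (is_derive_eq (dpow _)); rewrite e1; field; rewrite s0 a0.
- by apply: (is_derive_eq (dpow _)); rewrite e1; field; rewrite s0 a0.
- by apply: (is_derive_eq (dpow _)); rewrite e2; field; rewrite s0 a0.
Unshelve. all: by end_near. Qed.

(** * Regularity and admissibility of [Xi] *)

Lemma derivable_Xi_of (R : realType) (alpha beta gamma : R -> R) (rho : R) :
  smooth01 alpha -> smooth01 beta -> smooth01 gamma -> 0 < rho < 1 ->
  derivable (Xi_of alpha beta gamma) rho 1.
Proof.
move=> sa sb sg rho01; have /andP[rho0 _] := rho01.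
have da := smooth01_derivable sa rho01.
have db := smooth01_derivable sb rho01.
have dg := smooth01_derivable sg rho01.
(* [Xi] itself contains [alpha'] and [gamma'], so these must be differentiable as well. *)
have dda := smooth01_derivable (smooth01_derive1 sa) rho01.
have ddg := smooth01_derivable (smooth01_derive1 sg) rho01.
have dp (p : R) : derivable (fun r : R => r `^ p) rho 1.
  by apply: ex_derive; exact: is_derive1_powR.
have dga := derivableM (derivableM (derivableM (derivable_cst (3 : R) rho 1) ddg)
  (derivable_cst (2^-1 : R) rho 1)) (dp (2 / 3)).
have rho_neq0 : rho != 0 by rewrite gt_eqF.
have daq := derivableM da (derivableV (f := id) rho_neq0 (@derivable_id _ _ rho 1)).
have dgq : derivable (fun r => gamma r / r `^ (1 / 3)) rho 1.
  apply: (derivableM dg (derivableV _ (dp _))).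
  by rewrite gt_eqF ?powR_gt0.
apply/derivable_mxP => i j.
rewrite (_ : (fun x => _) = fun r => [:: beta r * r `^ (2 / 3); alpha r / r;
    alpha r / r; gamma r / r `^ (1 / 3);
    3 * derive1 gamma r / 2 * r `^ (2 / 3);
    3 * derive1 gamma r / 2 * r `^ (2 / 3);
    derive1 alpha r * r `^ (2 / 3)]`_j); last first.
  by apply/funext => r; rewrite mxE.
case: j => [[|[|[|[|[|[|[|m]]]]]]] mlt] /=.
- exact: (derivableM db (dp _)).
- exact: daq.
- exact: daq.
- exact: dgq.
- exact: dga.
- exact: dga.
- exact: (derivableM dda (dp _)).
- by case: (notF mlt).
Qed.

Lemma domG_Xi_of (R : realType) (alpha beta gamma : R -> R) (rho : R) :
  0 < rho -> 0 < alpha rho -> 0 < derive1 alpha rho ->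
  domG (Xi_of alpha beta gamma rho).
Proof.
move=> rho0 a0 da0; split; rewrite mxE idxE//= ?divr_gt0//.
by rewrite mulr_gt0 ?powR_gt0.
Qed.

(** * The discrete entropy inequality *)

Theorem mainTheorem4 (R : realType)
    (Phi : R -> R -> R -> R) (Gbar : 'rV[R]_7 -> R)
    (hPhi : forall v1 v2 v3 : R, 0 < v1 -> 0 < v2 -> 0 < v3 ->
      Phi v1 v2 v3 =
      Gbar (\row_(i < 7) [:: v1; v2; v3; v2 * v3; v1 * v3; v1 * v2;
                             v1 * v2 * v3]`_i))
    (G := G_of Gbar)
    (G_smooth : smooth_on [set p : 'rV[R]_7 * R | domG p.1 /\ 0 < p.2 < 1]
                  (fun p => G p.1 p.2))
    (G_convex : forall rho : R, 0 < rho < 1 ->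
      convex_function (@domG R) (fun X => G X rho))
    (alpha0 beta0 gamma0 v0 alpha beta gamma v : R -> R)
    (alpha0_smooth : smooth01 alpha0)
    (beta0_smooth : smooth01 beta0)
    (gamma0_smooth : smooth01 gamma0)
    (v0_smooth : smooth01 v0)
    (alpha_smooth : smooth01 alpha)
    (beta_smooth : smooth01 beta)
    (gamma_smooth : smooth01 gamma)
    (v_smooth : smooth01 v)
    (alpha0_ge0 : forall rho : R, 0 < rho < 1 -> 0 <= alpha0 rho)
    (dalpha0_gt0 : forall rho : R, 0 < rho < 1 -> 0 < derive1 alpha0 rho)
    (Xi0 := Xi_of alpha0 beta0 gamma0)
    (Xi := Xi_of alpha beta gamma)
    (Gamma0 := Gamma_of alpha0)
    (tau lambda : R) (tau_gt0 : 0 < tau) (lambda_gt0 : 0 < lambda)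
    (eq_v : forall rho : R, 0 < rho < 1 ->
      (v rho - v0 rho) / tau =
      derive1 (fun r : R => 3 * r `^ (2 / 3) *
         \sum_(i < 7) dG G i (Xi r) r * dOmega i (idx 1) (Gamma0 r) r) rho
      - rho `^ (- (1 / 3)) *
         \sum_(i < 7) dG G i (Xi rho) rho *
           (dOmega i (idx 2) (Gamma0 rho) rho
            + dOmega i (idx 3) (Gamma0 rho) rho))
    (eq_xi1567 : forall i : 'I_7, i \in [:: idx 1; idx 5; idx 6; idx 7] ->
      forall rho : R, 0 < rho < 1 ->
      (Xi rho 0 i - Xi0 rho 0 i) / tau =
      3 * rho `^ (2 / 3) *
        derive1 (fun r : R => dOmega i (idx 1) (Gamma0 r) r * v r) rho)
    (eq_xi234 : forall i : 'I_7, i \in [:: idx 2; idx 3; idx 4] ->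
      forall rho : R, 0 < rho < 1 ->
      (Xi rho 0 i - Xi0 rho 0 i) / tau =
      rho `^ (- (1 / 3)) *
        (dOmega i (idx 2) (Gamma0 rho) rho
         + dOmega i (idx 3) (Gamma0 rho) rho) * v rho)
    (xi2_at1 : Xi rho 0 (idx 2) @[rho --> (1 : R)^'-] --> lambda)
    (xi3_at1 : Xi rho 0 (idx 3) @[rho --> (1 : R)^'-] --> lambda)
    (xi2_ge0 : forall rho : R, 0 < rho < 1 -> 0 <= Xi rho 0 (idx 2))
    (xi3_ge0 : forall rho : R, 0 < rho < 1 -> 0 <= Xi rho 0 (idx 3))
    (xi7_gt0 : forall rho : R, 0 < rho < 1 -> 0 < Xi rho 0 (idx 7)) :
  forall rho : R, 0 < rho < 1 ->
    (entropy G (v rho) (Xi rho) rho - entropy G (v0 rho) (Xi0 rho) rho) / tau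
    - derive1 (fun r : R => 3 * r `^ (2 / 3) *
         (\sum_(i < 7) dG G i (Xi r) r * dOmega i (idx 1) (Gamma0 r) r)
         * v r) rho
    <= 0.

Proof.
move=> rho rho01; have /andP[rho0 rho1] := rho01.
(* The sign of [alpha'] is read off from [xi_7 = alpha' r^(2/3)]; below, that of [alpha] comes from
   [xi_2 = alpha / r]. *)
have dpos (r : R) : 0 < r < 1 -> 0 < derive1 alpha r.
  move=> r01; have /andP[r0 _] := r01.
  by have := xi7_gt0 _ r01; rewrite mxE idxE//= pmulr_lgt0 ?powR_gt0.
have alpha_gt0 : forall r : R, 0 < r < 1 -> 0 < alpha r.
  apply: gt0_of_derive1_gt0 => [r r01|r r01|]; last exact: dpos.
    exact: smooth01_derivable.
  have /andP[r0 _] := r01.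
  by have := xi2_ge0 _ r01; rewrite mxE idxE//= pmulr_lge0 ?invr_gt0.
have alpha0_gt0 : forall r : R, 0 < r < 1 -> 0 < alpha0 r.
  apply: gt0_of_derive1_gt0 => // r r01; exact: smooth01_derivable.
have DXi : domG (Xi rho) by apply: domG_Xi_of => //; [exact: alpha_gt0|exact: dpos].
have DXi0 : domG (Xi0 rho).
  by apply: domG_Xi_of => //; [exact: alpha0_gt0|exact: dalpha0_gt0].
have dXi : derivable Xi rho 1 by exact: derivable_Xi_of.
pose g i r := dG G i (Xi r) r.
pose A i r := dOmega i (idx 1) (Gamma0 r) r.
pose B i r := dOmega i (idx 2) (Gamma0 r) r + dOmega i (idx 3) (Gamma0 r) r.
have dg i : derivable (g i) rho 1
  := derivable_dG_curve (G := G) (i := i) (X := Xi) G_smooth (conj DXi rho01) dXi.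
have tangent : G (Xi rho) rho - G (Xi0 rho) rho <=
    \sum_(i < 7) g i rho * (Xi rho 0 i - Xi0 rho 0 i).
  apply: (domG_convex_tangent (f := fun X => G X rho)) => //; first exact: G_convex.
  exact: (smooth_section_differentiable (G := G) G_smooth (conj DXi rho01)).
(* The gap between the two sides is [(v - v0)^2 / 2]. *)
have kinetic : v rho ^+ 2 / 2 - v0 rho ^+ 2 / 2 <= v rho * (v rho - v0 rho).
  by have := sqr_ge0 (v rho - v0 rho); lra.
have idx_cases (i : 'I_7) : i \in [:: idx 1; idx 5; idx 6; idx 7] \/
    i \in [:: idx 2; idx 3; idx 4].
  rewrite !inE -!(inj_eq val_inj) /= !idxE//.
  by case: i => [[|[|[|[|[|[|[|m]]]]]]] ?] //=; [left|right|right|right|left|left|left].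
have A234 (i : 'I_7) : i \in [:: idx 2; idx 3; idx 4] -> A i = cst 0.
  move=> iI; apply/funext => r; rewrite /A /=.
  have [-> _ _] := dOmegaE (Gamma0 r) r i.
  by move: iI; rewrite !inE -!(inj_eq val_inj) /= !idxE// => /or3P[] /eqP ->.
have A1567 (i : 'I_7) : i \in [:: idx 1; idx 5; idx 6; idx 7] ->
    is_derive rho (1 : R) (A i)
      (rho `^ (- (1 / 3)) * B i rho / (3 * rho `^ (2 / 3))).
  move=> iI; apply: Omega_null_lagrangian => // r r01.
  exact: smooth01_derivable.
have dA i : derivable (A i) rho 1.
  have [iI|iI] := idx_cases i; first by have := A1567 _ iI => ?; exact: ex_derive.
  by rewrite A234.
have dv : derivable v rho 1 by exact: smooth01_derivable.
(* Both groups of equations take one common form. For [i = 1, 5, 6, 7] the product rule splits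
   [(A i v)'], and the null Lagrangian identity turns [3 rho^(2/3) (A i)' v] into
   [rho^(-1/3) B i v]; for [i = 2, 3, 4] the term in [v'] vanishes with [A i]. *)
have term i : g i rho * (Xi rho 0 i - Xi0 rho 0 i) / tau =
    3 * rho `^ (2 / 3) * (g i rho * A i rho) * derive1 v rho
    + rho `^ (- (1 / 3)) * (g i rho * B i rho) * v rho.
  rewrite -mulrA; have [iI|iI] := idx_cases i; last first.
    rewrite eq_xi234// -/(B i rho) A234//=; ring.
  have A' := A1567 _ iI.
  rewrite eq_xi1567// derive1E (deriveM (dA i) dv) derive1E.
  rewrite (derive_val (f := A i)) /GRing.scale /=.
  have s0 : rho `^ (2 / 3) != 0 by rewrite gt_eqF ?powR_gt0.
  by rewrite -/(A i rho); field.
(* [F] is the stress in the momentum equation, and [F v] is the entropy flux. *)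
pose F r := 3 * r `^ (2 / 3) * \sum_(i < 7) g i r * A i r.
have dF : derivable F rho 1.
  apply: derivableM.
    apply: derivableM; first exact: derivable_cst.
    by apply: ex_derive; exact: is_derive1_powR.
  rewrite (_ : (fun r => _) = \sum_(i < 7) (g i * A i)); last first.
    by apply/funext => r; rewrite fct_sumE.
  by apply: derivable_sum => i; exact: (derivableM (dg i) (dA i)).
have dFv : derive1 (fun r => F r * v r) rho =
    F rho * derive1 v rho + v rho * derive1 F rho.
  by rewrite derive1E (deriveM dF dv) !derive1E.
have Ev : (v rho - v0 rho) / tau = derive1 F rho
    - rho `^ (- (1 / 3)) * \sum_(i < 7) g i rho * B i rho := eq_v _ rho01.
rewrite -[X in derive1 X]/(fun r => F r * v r) dFv.
have sum_term : (\sum_(i < 7) g i rho * (Xi rho 0 i - Xi0 rho 0 i)) / tau =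
    F rho * derive1 v rho
    + rho `^ (- (1 / 3)) * (\sum_(i < 7) g i rho * B i rho) * v rho.
  rewrite mulr_suml (eq_bigr _ (fun i _ => term i)) big_split /=.
  by rewrite /F !mulr_sumr !mulr_suml.
(* Sum of the kinetic and tangent inequalities; dividing by [tau > 0] preserves the order. *)
have bound : (entropy G (v rho) (Xi rho) rho - entropy G (v0 rho) (Xi0 rho) rho)
    / tau <= v rho * ((v rho - v0 rho) / tau)
      + (\sum_(i < 7) g i rho * (Xi rho 0 i - Xi0 rho 0 i)) / tau.
  rewrite mulrA -mulrDl ler_pM2r ?invr_gt0// /entropy; lra.
apply: (le_trans (lerB bound (lexx _))).
(* The upper bound is now exactly zero: [v F'] and [F v'] cancel against [(F v)'], and the two sums
   with [B] cancel each other. *)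
by rewrite Ev sum_term; lra.
Qed.
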